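(* Let $m\ge 2$, let $A\leqslant \mathcal{A}_m$ be an abelian self-similar group, let $O_{(1)},\dots,O_{(s)}$ be the orbits of $A$ on the first level, let $\Delta=\langle x_1,\dots,x_s\rangle$ be the associated monoid of partial diagonal monomorphisms, and let $A^*=C_{\mathcal{A}_m}(\Delta(A))$. Then: (i) $A^*$ leaves each orbit $O_{(i)}$ invariant (that is, $R(\Delta(A))=1$, with $R$ as defined in the context), and $A^*=Stab_{A^*}(1)\,B(A)$; (ii) $Stab_{A^*}(1)=(A^* )^{x_1}(A^* )^{x_2}\cdots(A^* )^{x_s}$; (iii) $A^*=\overline{\Delta(B(A))}$; (iv) $A^*$ is a maximal abelian subgroup of $\mathcal{A}_m$ and is the unique one containing $\Delta(A)$.
   Context: Tree automorphisms. $Y=\{1,\dots,m\}$, $\mathcal{T}_m$ is the rooted $m$-ary tree whose vertices are the finite words over $Y$ (root the empty word, edges $(u,uy)$ with $y\in Y$), and $\mathcal{A}_m$ is its automorphism group, acting on the right; $Sym(m)$ embeds in $\mathcal{A}_m$ as the automorphisms $(e,\dots,e)\sigma$. Each $\alpha\in\mathcal{A}_m$ is written $\alpha=(\alpha_1,\dots,\alpha_m)\sigma(\alpha)$, where $\sigma(\alpha)\in Sym(Y)$ is the permutation induced on the first level (the activity of $\alpha$), $\alpha_y\in\mathcal{A}_m$, and $(y_1y_2\cdots y_n)^{\alpha}=(y_1)^{\sigma(\alpha)}(y_2\cdots y_n)^{\alpha_{y_1}}$. The set of states of $\alpha$ is defined recursively by $Q(\alpha)=\{\alpha\}\cup\bigcup_{i}Q(\alpha_i)$.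 A subgroup $G\leqslant\mathcal{A}_m$ is self-similar if $Q(\alpha)\subseteq G$ for all $\alpha\in G$. The identity is $e$. $Stab_G(k)$ is the subgroup of $G$ fixing every vertex of level $k$. $\mathcal{A}_m$ is a topological group in which the subgroups $Stab_{\mathcal{A}_m}(k)$ form a basis of neighbourhoods of $e$; a bar denotes topological closure. Orbits. For $G\leqslant\mathcal{A}_m$, $P(G)\leqslant Sym(m)$ is the group of activities of elements of $G$. Its orbits on $Y$ are $O_{(1)}=\{1,\dots,m_1\}$, $O_{(2)}=\{m_1+1,\dots,m_1+m_2\}$, $\dots$, $O_{(s)}=\{m_1+\dots+m_{s-1}+1,\dots,m\}$. $P_{(i)}$ is the transitive group induced by $P(G)$ on $O_{(i)}$ (viewed as fixing the other points of $Y$). Each $\sigma\in P(G)$ decomposes as $\sigma=\sigma_{(1)}\cdots\sigma_{(s)}$ with $\sigma_{(i)}\in P_{(i)}$. $B(G)$. For $\alpha=(\alpha_1,\dots,\alpha_m)\sigma\in G$, let $\alpha_{[i]}\in\mathcal{A}_m$ be the automorphism with activity $\sigma_{(i)}$, with first-level state $\alpha_y$ at each $y\in O_{(i)}$ and $e$ at each $y\notin O_{(i)}$. Put $G_{[i]}=\{\alpha_{[i]}\mid\alpha\in G\}$ and $B(G)=G_{[1]}\cdots G_{[s]}$ (a direct product). $R(G)$. A permutation $\xi\in Sym(m)$ is rigid (with respect to the orbits of $P(G)$) if it permutes the set of orbits and for each $i$ and all $k\le l$ in $O_{(i)}$ one has $(k)\xi\le(l)\xi$. $S(P(G))$ is the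 group of rigid permutations, and $S(G)=\{\xi\in S(P(G))\mid C_{\mathcal{A}_m}(G)\cap Stab_{\mathcal{A}_m}(1)\xi\neq\emptyset\}$. For each $\xi\in S(G)$ choose a lifting, i.e. an element of $C_{\mathcal{A}_m}(G)\cap Stab_{\mathcal{A}_m}(1)\xi$; $R(G)$ is the group generated by these liftings. $\Delta$. For $1\le i\le s$, $x_i:\mathcal{A}_m\to\mathcal{A}_m$ sends $\alpha$ to the automorphism with trivial activity having $\alpha$ in every coordinate from $O_{(i)}$ and $e$ in all other coordinates; the orbits used are those of $A$. $\Delta=\langle x_1,\dots,x_s\rangle$ is the monoid generated under composition (maps written on the right as exponents), and for a subgroup $H$, $\Delta(H)=\langle H^{\omega}\mid\omega\in\Delta\rangle$.
   Formalization: A is assumed nontrivial (for A = {e}, A* is the whole automorphism group, which is not abelian), and in R(Δ(A)) = 1 the lifting chosen for the identity permutation is required to be e, since otherwise R(Δ(A)) could be nontrivial. *)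

(* Defs.v *)
From HB Require Import structures.
From mathcomp Require Import all_boot all_order all_fingroup.
From mathcomp Require Import boolp classical_sets filter topology.

Set Implicit Arguments.
Unset Strict Implicit.
Unset Printing Implicit Defensive.

Local Open Scope classical_set_scope.
Local Open Scope group_scope.

Definition tree_edge (m : nat) (u v : seq 'I_m) : Prop :=
  exists y : 'I_m, v = rcons u y.

Definition is_tree_aut (m : nat) (f : seq 'I_m -> seq 'I_m) : Prop :=
  [/\ bijective f, f [::] = [::] &
      forall u v, tree_edge u v <-> tree_edge (f u) (f v)].

Record tree_aut (m : nat) := TreeAut {
  tree_fun :> seq 'I_m -> seq 'I_m;
  tree_funP : is_tree_aut tree_fun }.

HB.instance Definition _ (m : nat) := gen_eqMixin (tree_aut m).
HB.instance Definition _ (m : nat) := gen_choiceMixin (tree_aut m).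

Lemma tree_autP (m : nat) (a b : tree_aut m) :
  (forall w, a w = b w) -> a = b.
Proof.
case: a b => [f fP] [g gP] /= /funext fg; rewrite -fg in gP *.
by congr TreeAut; exact: Prop_irrelevance.
Qed.

Section TreeGroup.
Variable m : nat.
Implicit Types (a b c : tree_aut m) (f g : seq 'I_m -> seq 'I_m).

Lemma is_tree_aut_id : is_tree_aut (@id (seq 'I_m)).
Proof. by split=> //; exists id. Qed.

Lemma is_tree_aut_comp f g :
  is_tree_aut f -> is_tree_aut g -> is_tree_aut (g \o f).
Proof.
move=> [fb f0 fe] [gb g0 ge]; split; first exact: bij_comp.
  by rewrite /= f0.
by move=> u v; rewrite fe ge.
Qed.

Lemma is_tree_aut_can f g :
  is_tree_aut f -> cancel f g -> cancel g f -> is_tree_aut g.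
Proof.
move=> [_ f0 fe] fK gK; split; first by exists f.
  by rewrite -f0 fK.
by move=> u v; rewrite (fe (g u) (g v)) !gK.
Qed.

Lemma tree_inv_ex a : exists g : seq 'I_m -> seq 'I_m,
  cancel a g /\ cancel g a.
Proof. by case: (tree_funP a) => -[g aK gK] _ _; exists g. Qed.

Definition tree_inv_fun a := projT1 (cid (tree_inv_ex a)).

Lemma tree_invK a : cancel a (tree_inv_fun a) /\ cancel (tree_inv_fun a) a.
Proof. exact: projT2 (cid (tree_inv_ex a)). Qed.

Definition tree_one : tree_aut m := TreeAut is_tree_aut_id.
(* Right action: in a product the left factor is applied first. *)
Definition tree_mul a b : tree_aut m :=
  TreeAut (is_tree_aut_comp (tree_funP a) (tree_funP b)).
Definition tree_inv a : tree_aut m :=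
  TreeAut (is_tree_aut_can (tree_funP a) (tree_invK a).1 (tree_invK a).2).

Lemma tree_mulA : associative tree_mul.
Proof. by move=> a b c; exact: tree_autP. Qed.
Lemma tree_mul1 : left_id tree_one tree_mul.
Proof. by move=> a; exact: tree_autP. Qed.
Lemma tree_mulr1 : right_id tree_one tree_mul.
Proof. by move=> a; exact: tree_autP. Qed.
Lemma tree_mulV : left_inverse tree_one tree_inv tree_mul.
Proof. by move=> a; apply: tree_autP => w /=; rewrite (tree_invK a).2. Qed.
Lemma tree_mulrV : right_inverse tree_one tree_inv tree_mul.
Proof. by move=> a; apply: tree_autP => w /=; rewrite (tree_invK a).1. Qed.

HB.instance Definition _ := isGroup.Build (tree_aut m)
  tree_mulA tree_mul1 tree_mulr1 tree_mulV tree_mulrV.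

Lemma tree_mulE a b w : (a * b) w = b (a w).
Proof. by []. Qed.

Lemma tree_oneE w : (1 : tree_aut m) w = w.
Proof. by []. Qed.

Lemma tree_nil a : a [::] = [::].
Proof. by case: (tree_funP a). Qed.

Lemma tree_rcons a u y : exists z, a (rcons u y) = rcons (a u) z.
Proof. by case: (tree_funP a) => _ _ /(_ u (rcons u y))[+ _]; apply; exists y. Qed.

Lemma tree_size a u : size (a u) = size u.
Proof.
elim/last_ind: u => [|u y IH]; first by rewrite tree_nil.
by have [z ->] := tree_rcons a u y; rewrite !size_rcons IH.
Qed.

Lemma tree_prefix a u v : exists w, a (u ++ v) = a u ++ w.
Proof.
elim/last_ind: v => [|v y [w IH]]; first by exists [::]; rewrite !cats0.
have [z] := tree_rcons a (u ++ v) y.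
by rewrite -rcons_cat => ->; exists (rcons w z); rewrite IH rcons_cat.
Qed.

Definition act_fun a (y : 'I_m) : 'I_m := head y (a [:: y]).

Lemma act_funE a y : a [:: y] = [:: act_fun a y].
Proof.
by rewrite /act_fun; have := tree_size a [:: y]; case: (a _) => [|z []].
Qed.

Lemma act_fun_inj a : injective (act_fun a).
Proof.
move=> y z yz; have [/bij_inj ainj _ _] := tree_funP a.
by have /ainj[] : a [:: y] = a [:: z] by rewrite !act_funE yz.
Qed.

Definition activity a : 'S_m := perm (@act_fun_inj a).

Definition section_fun a (y : 'I_m) (w : seq 'I_m) := behead (a (y :: w)).

Lemma section_funE a y w : a (y :: w) = activity a y :: section_fun a y w.
Proof.
rewrite /section_fun -cat1s; have [v ->] := tree_prefix a [:: y] w.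
by rewrite act_funE permE.
Qed.

Lemma tree_edge_cons (y : 'I_m) u v : tree_edge (y :: u) (y :: v) <-> tree_edge u v.
Proof.
by split=> -[z]; [rewrite rcons_cons => -[->] | move=> ->]; exists z.
Qed.

Lemma section_subproof a y : is_tree_aut (section_fun a y).
Proof.
have [/bij_inj ainj _ ae] := tree_funP a; split.
- pose b := tree_inv a.
  have ab w : a (b w) = w by exact: (tree_invK a).2.
  have ba w : b (a w) = w by exact: (tree_invK a).1.
  have by_ : activity b (activity a y) = y.
    by rewrite !permE; have := ba [:: y]; rewrite !act_funE => -[].
  exists (section_fun b (activity a y)) => w.
    by have := ba (y :: w); rewrite !section_funE => -[_ ->].
  have := ab (activity a y :: w); rewrite [b _]section_funE by_ section_funE.
  by case.
- by rewrite /section_fun act_funE.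
- by move=> u v; rewrite -(tree_edge_cons y) ae !section_funE tree_edge_cons.
Qed.

Definition state a y : tree_aut m := TreeAut (section_subproof a y).

Lemma tree_cons a y w : a (y :: w) = activity a y :: state a y w.
Proof. exact: section_funE. Qed.

Definition wreath_fun (b : 'I_m -> tree_aut m) (s : 'S_m) (w : seq 'I_m) :=
  if w is y :: v then s y :: b y v else [::].

Lemma wreath_subproof (b : 'I_m -> tree_aut m) (s : 'S_m) :
  is_tree_aut (wreath_fun b s).
Proof.
split=> //.
- exists (fun w => if w is y :: v
                   then s^-1 y :: tree_inv (b (s^-1 y)) v else [::]).
    by case=> //= y v; rewrite permK (tree_invK (b y)).1.
  by case=> //= y v; rewrite permKV (tree_invK (b (s^-1 y))).2.
- case=> [|y u] [|z v] /=.
  + by split=> -[].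
  + split=> -[x [_ v0]].
      by subst v; exists (s z); rewrite tree_nil.
    move: v0 => /= v0; have := tree_size (b z) v; rewrite v0 => /esym/size0nil ->.
    by exists z.
  + by split=> -[].
  + have [_ _ be] := tree_funP (b y); split=> -[x] [].
      move=> -> ->; have [t ->] := tree_rcons (b y) u x.
      by exists t.
    move=> /perm_inj zy; subst z => vx.
    have [t ->] : tree_edge u v by apply/be; exists x.
    by exists t.
Qed.

(* The automorphism (b_1, ..., b_m) s. *)
Definition wreath (b : 'I_m -> tree_aut m) (s : 'S_m) : tree_aut m :=
  TreeAut (wreath_subproof b s).

Lemma wreath_decomp a : a = wreath (state a) (activity a).
Proof.
by apply: tree_autP => -[|y w]; [rewrite tree_nil | rewrite tree_cons].
Qed.

Lemma activity_wreath (b : 'I_m -> tree_aut m) (s : 'S_m) :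
  activity (wreath b s) = s.
Proof. by apply/permP => y; rewrite permE. Qed.

Lemma state_wreath (b : 'I_m -> tree_aut m) (s : 'S_m) y :
  state (wreath b s) y = b y.
Proof. exact: tree_autP. Qed.

Definition rooted (s : 'S_m) : tree_aut m := wreath (fun _ => 1) s.

End TreeGroup.

Section Subgroups.
Variable T : groupType.
Implicit Types G H X : set T.

Definition is_subgroup G : Prop :=
  G 1 /\ forall a b, G a -> G b -> G (a * b^-1).

Definition is_abelian G : Prop := forall a b, G a -> G b -> commute a b.

Definition generated X : set T := smallest is_subgroup X.

Definition centralizer G : set T := [set a | forall g, G g -> commute a g].

Definition set_prod G H : set T := [set a * b | a in G & b in H].

Definition maximal_abelian G : Prop :=
  [/\ is_subgroup G, is_abelian G &
      forall H, is_subgroup H -> is_abelian H -> G `<=` H -> H = G].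

End Subgroups.

Notation "\setprod_ ( i < s ) F" := (\big[@set_prod _/[set 1]]_(i < s) F)
  (at level 41, F at level 41, i, s at level 50,
   format "'[' \setprod_ ( i  <  s ) '/  '  F ']'") : classical_set_scope.

Section Stabilizers.
Variable m : nat.
Implicit Types (a b : tree_aut m) (G : set (tree_aut m)).

Definition Stab G (k : nat) : set (tree_aut m) :=
  [set a | G a /\ forall u, size u = k -> a u = u].

(* The recursive equation Q(a) = {a} u U_y Q(a_y), read as a least solution. *)
Inductive states : tree_aut m -> set (tree_aut m) :=
| states_refl a : states a a
| states_step a y b : states (state a y) b -> states a b.

Definition self_similar G : Prop := forall a, G a -> states a `<=` G.

(* Neighbourhoods of a: the sets containing some a Stab(k). *)
Definition tree_nbhs a : set_system (tree_aut m) :=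
  filter_from setT (fun k => [set a * b | b in Stab setT k]).

Lemma tree_cosetP a k c :
  [set a * b | b in Stab setT k] c <-> forall u, size u = k -> c u = a u.
Proof.
split=> [[b [_ bk] <-] u uk|ca].
  by rewrite tree_mulE bk // tree_size.
exists (a^-1 * c); last by rewrite mulKVg.
split=> // u uk; rewrite tree_mulE ca ?tree_size //.
by rewrite -[in LHS]tree_mulE mulVg.
Qed.

Lemma tree_prefix_le a b k l : (k <= l)%N ->
  (forall u, size u = l -> a u = b u) -> forall u, size u = k -> a u = b u.
Proof.
move=> kl ab u uk; case: u uk => [|y u] uk; first by rewrite !tree_nil.
pose v := nseq (l - k) y.
have /ab : size ((y :: u) ++ v) = l by rewrite size_cat uk size_nseq subnKC.
have [w1 ->] := tree_prefix a (y :: u) v.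
have [w2 ->] := tree_prefix b (y :: u) v.
by move=> /(congr1 (take k)); rewrite !take_size_cat ?tree_size.
Qed.

Lemma tree_nbhs_filter a : ProperFilter (tree_nbhs a).
Proof.
apply: filter_from_proper; last first.
  by move=> k _; exists a; apply/tree_cosetP.
apply: filter_from_filter; first by exists 0%N.
move=> i j _ _; exists (maxn i j) => // c /tree_cosetP ca.
by split; apply/tree_cosetP; apply: tree_prefix_le ca;
  rewrite (leq_maxl, leq_maxr).
Qed.

Lemma tree_nbhs_singleton a (U : set (tree_aut m)) : tree_nbhs a U -> U a.
Proof. by move=> [k _]; apply; apply/tree_cosetP. Qed.

Lemma tree_nbhs_nbhs a (U : set (tree_aut m)) :
  tree_nbhs a U -> tree_nbhs a (tree_nbhs^~ U).
Proof.
move=> [k _ kU]; exists k => // b /tree_cosetP ba.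
exists k => // c /tree_cosetP cb; apply: kU; apply/tree_cosetP => u uk.
by rewrite cb // ba.
Qed.

HB.instance Definition _ := hasNbhs.Build (tree_aut m) tree_nbhs.
HB.instance Definition _ := Nbhs_isNbhsTopological.Build (tree_aut m)
  tree_nbhs_filter tree_nbhs_singleton tree_nbhs_nbhs.

End Stabilizers.

Section Orbits.
Variable m : nat.
Implicit Types (a : tree_aut m) (G : set (tree_aut m)) (O : {set 'I_m}).

(* P(G) *)
Definition activities G : {set 'S_m} :=
  [set s : 'S_m | `[< exists2 a, G a & activity a = s >]]%SET.

Definition orbits1 G : {set {set 'I_m}} :=
  [set orbit 'P (activities G) y | y : 'I_m]%SET.

(* O_(1), ..., O_(s) lists the orbits of G on the first level, each once; the
   numbering of the orbits and the labelling of the letters are arbitrary. *)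
Definition orbit_numbering G (s : nat) (O : 'I_s -> {set 'I_m}) : Prop :=
  injective O /\ (O @: [set: 'I_s])%SET = orbits1 G.

(* alpha_[i], for O = O_(i); restr_perm O (activity a) is sigma_(i). *)
Definition orbit_part O a : tree_aut m :=
  wreath (fun y => if y \in O then state a y else 1) (restr_perm O (activity a)).

(* B(G) = G_[1] ... G_[s], with G_[i] the set of alpha_[i], alpha in G. *)
Definition Bgroup (s : nat) (O : 'I_s -> {set 'I_m}) G : set (tree_aut m) :=
  \setprod_(i < s) (orbit_part (O i) @` G).

(* The map x_i, for O = O_(i). *)
Definition partial_diag O a : tree_aut m :=
  wreath (fun y => if y \in O then a else 1) 1.

Definition is_submonoid_End (M : set (tree_aut m -> tree_aut m)) : Prop :=
  M id /\ forall f g, M f -> M g -> M (g \o f).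

Definition Delta_monoid (s : nat) (O : 'I_s -> {set 'I_m}) :
    set (tree_aut m -> tree_aut m) :=
  smallest is_submonoid_End [set partial_diag (O i) | i in [set: 'I_s]].

Definition Delta (s : nat) (O : 'I_s -> {set 'I_m}) (H : set (tree_aut m)) :
    set (tree_aut m) :=
  generated (\bigcup_(w in Delta_monoid O) (w @` H)).

Definition rigid G (xi : 'S_m) : Prop :=
  (forall O, O \in orbits1 G -> (xi @: O)%SET \in orbits1 G) /\
  (forall O, O \in orbits1 G -> forall k l : 'I_m, k \in O -> l \in O ->
     (k <= l)%N -> (xi k <= xi l)%N).

Definition liftings G (xi : 'S_m) : set (tree_aut m) :=
  centralizer G `&` [set b * rooted xi | b in Stab setT 1].

Definition Sgroup G : set 'S_m := [set xi | rigid G xi /\ liftings G xi !=set0].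

(* The trivial permutation is lifted to the identity: otherwise the group
   generated by the liftings could be nontrivial even when S(G) = 1. *)
Definition lifting_choice G (lift : 'S_m -> tree_aut m) : Prop :=
  (forall xi, Sgroup G xi -> liftings G xi (lift xi)) /\ lift 1 = 1.

Definition Rgroup G (lift : 'S_m -> tree_aut m) : set (tree_aut m) :=
  generated (lift @` Sgroup G).

End Orbits.

(* Main.v *)
(* The proof rests on a recursive description of [Astar], the centralizer of
   [Delta(A)].  Since [A] is abelian and self-similar, [Delta(A)] is abelian,
   and both [B(A)] and [x_i(Astar)] lie in [Astar].  Conversely let [c] commute
   with [Delta(A)].  Commuting with [x_i(b)], [b <> 1], forces [c] to preserve
   [O_i]; a permutation of [O_i] commuting with the transitive abelian group
   induced by [A] is induced by an element [a] of [A]; and after dividing by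
   [a_[i]] the states of [c] on [O_i] are all equal to one [e] in [Astar].  So
   [c] is a product over [i] of elements [x_i(e_i) (a_i)_[i]] with [e_i] in
   [Astar], and that [Astar] is abelian and that [Delta(B(A))] is dense in it
   follow level by level. *)
Require Import Defs.
From mathcomp Require Import all_boot all_order all_fingroup.
From mathcomp Require Import boolp classical_sets filter topology.

Set Implicit Arguments.
Unset Strict Implicit.
Unset Printing Implicit Defensive.

Local Open Scope classical_set_scope.
Local Open Scope group_scope.

(** * Subgroups, centralizers and indexed products of subsets of a group *)

Section GroupSets.
Variable T : groupType.
Implicit Types (G H K X : set T).

Lemma setprodP (s : nat) (F : 'I_s -> set T) (x : T) :
  (\setprod_(i < s) F i) x <->
  exists2 f : 'I_s -> T, forall i, F i (f i) & x = \prod_(i < s) f i.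
Proof.
elim: s F x => [|s IH] F x.
  rewrite big_ord0; split=> [->|[f _ ->]]; last by rewrite big_ord0.
  by exists (fun=> 1); [case | rewrite big_ord0].
rewrite big_ord_recl; split=> [[a Fa [b /IH[g Fg ->] <-]]|[f Ff ->]].
  exists (fun i => if unlift ord0 i is Some j then g j else a).
    by move=> i; case: unliftP => [j ->|->].
  rewrite big_ord_recl unlift_none; congr (_ * _).
  by apply: eq_bigr => j _; rewrite liftK.
rewrite big_ord_recl; exists (f ord0); first exact: Ff.
exists (\prod_(i < s) f (lift ord0 i)) => //.
by apply/IH; exists (fun i => f (lift ord0 i)).
Qed.

Lemma subgroupV G a : is_subgroup G -> G a -> G a^-1.
Proof. by move=> [G1 GV] Ga; rewrite -[_^-1]mul1g; apply: GV. Qed.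

Lemma subgroupM G a b : is_subgroup G -> G a -> G b -> G (a * b).
Proof.
move=> Gg Ga Gb; rewrite -[b]invgK.
by apply: Gg.2 => //; apply: subgroupV.
Qed.

Lemma subgroup_prod G (s : nat) (f : 'I_s -> T) :
  is_subgroup G -> (forall i, G (f i)) -> G (\prod_(i < s) f i).
Proof.
move=> Gg Gf; apply: (big_ind G) => //; first exact: Gg.1.
by move=> a b; apply: subgroupM.
Qed.

Lemma subgroupI G H : is_subgroup G -> is_subgroup H -> is_subgroup (G `&` H).
Proof.
move=> [G1 GV] [H1 HV]; split=> // a b [Ga Ha] [Gb Hb].
by split; [apply: GV | apply: HV].
Qed.

Lemma generated_subgroup X : is_subgroup (Defs.generated X).
Proof.
split=> [H [[]]|a b Xa Xb H HX] //.
by apply: HX.1.2; [apply: Xa | apply: Xb].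
Qed.

Lemma centralizer_subgroup G : is_subgroup (centralizer G).
Proof.
split=> [g _|a b Ca Cb g Gg]; first exact/commute_sym/commute1.
apply/commute_sym/commuteM; first exact/commute_sym/Ca.
exact/commuteV/commute_sym/Cb.
Qed.

End GroupSets.

(** * Activities and states of products, of [partial_diag] and of [orbit_part] *)

Section Tree.
Variable m : nat.
Implicit Types (a b c d : tree_aut m) (B H K : set (tree_aut m)) (Q : {set 'I_m}).

Lemma activityM a b y : activity (a * b) y = activity b (activity a y).
Proof.
by have := tree_cons (a * b) y [::]; rewrite tree_mulE !tree_cons => -[<-].
Qed.

Lemma stateM a b y : state (a * b) y = state a y * state b (activity a y).
Proof.
apply: tree_autP => w; have := tree_cons (a * b) y w.
by rewrite tree_mulE !tree_cons => -[_ /esym].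
Qed.

Lemma activity1 y : activity (1 : tree_aut m) y = y.
Proof. by have := tree_cons 1 y [::]; rewrite tree_oneE => -[]. Qed.

Lemma state1 y : state (1 : tree_aut m) y = 1.
Proof.
(* Since [1 * 1 = 1] and [1] fixes [y], this state is idempotent, hence trivial. *)
apply: (mulgI (state 1 y)); rewrite mulg1 -{2}[y]activity1 -stateM.
by rewrite mulg1.
Qed.

Lemma eq_tree_aut a b : (forall y, activity a y = activity b y) ->
  (forall y, state a y = state b y) -> a = b.
Proof.
move=> ab1 ab2; apply: tree_autP => -[|y w]; first by rewrite !tree_nil.
by rewrite !tree_cons ab1 ab2.
Qed.

Lemma tree_commuteP a b : commute a b <-> forall y,
  activity b (activity a y) = activity a (activity b y) /\
  state a y * state b (activity a y) = state b y * state a (activity b y).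
Proof.
split=> [ab y|ab]; first by rewrite -!activityM -!stateM ab.
by apply: eq_tree_aut => y; rewrite ?activityM ?stateM; have [] := ab y.
Qed.

Lemma Stab1P B c : Stab B 1 c <-> B c /\ forall y, activity c y = y.
Proof.
split=> -[Bc c1]; split=> //.
  by move=> y; have := c1 [:: y] (erefl _); rewrite tree_cons => -[].
by move=> [|y []] // _; rewrite tree_cons c1 tree_nil.
Qed.

Lemma activity_pd Q a y : activity (partial_diag Q a) y = y.
Proof. by rewrite activity_wreath perm1. Qed.

Lemma state_pd Q a y : state (partial_diag Q a) y = if y \in Q then a else 1.
Proof. exact: state_wreath. Qed.

Lemma partial_diagM Q a b :
  partial_diag Q (a * b) = partial_diag Q a * partial_diag Q b.
Proof.
apply: eq_tree_aut => y; rewrite ?activityM ?stateM !activity_pd //.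
by rewrite !state_pd; case: ifP; rewrite ?mul1g.
Qed.

Lemma partial_diag1 Q : partial_diag Q 1 = 1.
Proof.
apply: eq_tree_aut => y; first by rewrite activity_pd activity1.
by rewrite state_pd if_same state1.
Qed.

Lemma partial_diagV Q a : partial_diag Q a^-1 = (partial_diag Q a)^-1.
Proof.
apply: (mulIg (partial_diag Q a)).
by rewrite -partial_diagM !mulVg partial_diag1.
Qed.

(** [partial_diag Q] is an endomorphism; pulling back subgroups lets minimality of a generated
    subgroup be used through it. *)
Lemma partial_diag_preim Q K : is_subgroup K ->
  is_subgroup [set g | K (partial_diag Q g)].
Proof.
move=> [K1 KV]; split=> [|a b Ka Kb] /=; first by rewrite partial_diag1.
by rewrite partial_diagM partial_diagV; apply: KV.
Qed.

Lemma partial_diag_id Q a y w :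
  y \notin Q -> partial_diag Q a (y :: w) = y :: w.
Proof. by move=> /negPf yQ; rewrite tree_cons activity_pd state_pd yQ. Qed.

Lemma state_op Q a y :
  state (orbit_part Q a) y = if y \in Q then state a y else 1.
Proof. exact: state_wreath. Qed.

Lemma activity_op_out Q a y : y \notin Q -> activity (orbit_part Q a) y = y.
Proof.
by move=> yQ; rewrite activity_wreath; apply: (out_perm (restr_perm_on _ _)).
Qed.

(** [restr_perm] is trivial on permutations that do not stabilize [Q], hence the invariance
    hypothesis. *)
Lemma activity_op_in Q a y : (forall z, z \in Q -> activity a z \in Q) ->
  y \in Q -> activity (orbit_part Q a) y = activity a y.
Proof.
move=> aQ yQ; rewrite activity_wreath restr_permE //.
rewrite inE; apply/andP; split; first by rewrite inE.
by rewrite inE; apply/fintype.subsetP => z zQ; rewrite inE; apply: aQ.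
Qed.

Lemma orbit_part_id Q a y w : y \notin Q -> orbit_part Q a (y :: w) = y :: w.
Proof. by move=> yQ; rewrite tree_cons activity_op_out // state_op (negPf yQ). Qed.

(** * Products of automorphisms supported on disjoint blocks of letters *)

Section Blocks.
Variables (s : nat) (O : 'I_s -> {set 'I_m}) (f : 'I_s -> tree_aut m).
Hypothesis O_disj : forall i j y, y \in O i -> y \in O j -> i = j.
Hypothesis f_in : forall i y, y \in O i -> activity (f i) y \in O i.
Hypothesis f_id : forall i y w, y \notin O i -> f i (y :: w) = y :: w.

(** Factors other than [f i] fix every word starting in [O i], and [f i] keeps the first letter
    there, so only that factor is seen. *)
Lemma block_prod_cons i y w :
  y \in O i -> (\prod_(j < s) f j) (y :: w) = f i (y :: w).
Proof.
(* The induction is on a duplicate-free list of indices, with the word general because [f i] changes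
   it. *)
move=> yOi; have aux (r : seq 'I_s) z v : z \in O i -> uniq r ->
    (\prod_(j <- r) f j) (z :: v) = if i \in r then f i (z :: v) else z :: v.
  elim: r z v => [|j r IH] z v zOi; first by rewrite big_nil.
  rewrite big_cons tree_mulE in_cons => /andP[jr r_uniq].
  case: (eqVneq i j) jr => [<- ir|ij jr] /=.
    by rewrite tree_cons IH ?f_in // (negPf ir).
  by rewrite f_id ?IH //; apply: contraNN ij => /(O_disj zOi) ->.
by rewrite aux ?index_enum_uniq // mem_index_enum.
Qed.

Lemma activity_block_prod i y :
  y \in O i -> activity (\prod_(j < s) f j) y = activity (f i) y.
Proof. by move=> /(@block_prod_cons _ _ [::]); rewrite !tree_cons => -[]. Qed.

Lemma state_block_prod i y :
  y \in O i -> state (\prod_(j < s) f j) y = state (f i) y.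
Proof.
move=> yOi; apply: tree_autP => w.
by have := block_prod_cons w yOi; rewrite !tree_cons => -[].
Qed.

End Blocks.

(** * Closure and induction principles for [Delta] *)

Section DeltaClosure.
Variables (s : nat) (O : 'I_s -> {set 'I_m}) (H : set (tree_aut m)).

Lemma Delta_subgroup : is_subgroup (Delta O H).
Proof. exact: generated_subgroup. Qed.

Lemma Delta_monoid_submonoid : is_submonoid_End (Delta_monoid O).
Proof.
split=> [M [[]]|f g Mf Mg M MO] //.
by apply: MO.1.2; [apply: Mf | apply: Mg].
Qed.

Lemma sub_Delta : H `<=` Delta O H.
Proof.
move=> a Ha; apply: sub_gen_smallest; exists id; last by exists a.
exact: Delta_monoid_submonoid.1.
Qed.

Lemma Delta_pd i a : Delta O H a -> Delta O H (partial_diag (O i) a).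
Proof.
move: a; apply: smallest_sub.
  by apply: partial_diag_preim; apply: Delta_subgroup.
move=> _ [w Mw [a Ha <-]]; apply: sub_gen_smallest.
exists (partial_diag (O i) \o w); last by exists a.
apply: Delta_monoid_submonoid.2 => //.
by apply: sub_gen_smallest; exists i.
Qed.

(** The maps sending [K] into itself form a submonoid containing every [x_i], hence all of
    [Delta_monoid O]. *)
Lemma Delta_sub K : is_subgroup K -> H `<=` K ->
  (forall i a, K a -> K (partial_diag (O i) a)) -> Delta O H `<=` K.
Proof.
move=> Kg HK Kx; apply: smallest_sub => // _ [w Mw [a Ha <-]].
have {}Mw : [set f : tree_aut m -> tree_aut m | forall b, K b -> K (f b)] w.
  apply: Mw; split=> [|_ [i _ <-]]; last exact: Kx.
  by split=> // f g Kf Kf' b Kb; exact: (Kf' _ (Kf _ Kb)).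
by apply: Mw; apply: HK.
Qed.

Lemma Delta_ind K : is_subgroup K -> H `<=` K ->
  (forall i a, Delta O H a -> K (partial_diag (O i) a)) -> Delta O H `<=` K.
Proof.
move=> Kg HK Kx; suff: Delta O H `<=` Delta O H `&` K by move=> sub a /sub[].
apply: Delta_sub => [|a Ha|i a [Da _]].
- by apply: subgroupI => //; apply: Delta_subgroup.
- by split; [apply: sub_Delta | apply: HK].
- by split; [apply: Delta_pd | apply: Kx].
Qed.

End DeltaClosure.

End Tree.

(** * First-level orbits of [A] *)

Section AbelianSelfSimilar.
Variables (m : nat) (A : set (tree_aut m)).
Hypothesis A_subgroup : is_subgroup A.
Hypothesis A_abelian : is_abelian A.
Hypothesis A_selfsim : self_similar A.
Variables (s : nat) (O : 'I_s -> {set 'I_m}).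
Hypothesis O_orbits : orbit_numbering A O.
Implicit Types (a b c d e : tree_aut m) (i j : 'I_s) (y z : 'I_m).

Local Notation D := (Delta O A).
Local Notation Astar := (centralizer (Delta O A)).

(** [activities A] is a bare set, so an orbit unfolds to the images of a base point; invariance and
    transitivity then come from the group law of [A]. *)
Lemma orbit_mem i : exists y0, forall z,
  z \in O i <-> exists2 a, A a & activity a y0 = z.
Proof.
have : O i \in orbits1 A by rewrite -O_orbits.2 imset_f.
case/imsetP => y0 _ ->; exists y0 => z; split.
  by case/orbitP => p; rewrite inE => /asboolP[a Aa <-] <-; exists a.
case=> a Aa <-; apply/orbitP; exists (activity a) => //.
by rewrite inE; apply/asboolP; exists a.
Qed.

Lemma orbit_in i a y : A a -> y \in O i -> activity a y \in O i.
Proof.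
have [y0 O0] := orbit_mem i => Aa /O0[b Ab <-]; apply/O0.
by exists (b * a); [apply: subgroupM | rewrite activityM].
Qed.

Lemma orbit_notin i a y : A a -> y \notin O i -> activity a y \notin O i.
Proof.
move=> Aa; apply: contraNN => ayi.
have -> : y = activity a^-1 (activity a y) by rewrite -activityM mulgV activity1.
by apply: orbit_in => //; apply: subgroupV.
Qed.

Lemma orbit_trans i y z :
  y \in O i -> z \in O i -> exists2 a, A a & activity a y = z.
Proof.
have [y0 O0] := orbit_mem i => /O0[b Ab <-] /O0[c Ac <-].
exists (b^-1 * c); first by apply: subgroupM => //; apply: subgroupV.
by rewrite -activityM mulKVg.
Qed.

Lemma orbit_cover y : exists i, y \in O i.
Proof.
have : orbit 'P (activities A) y \in orbits1 A by rewrite imset_f.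
rewrite -O_orbits.2 => /imsetP[i _ Oi]; exists i; rewrite -Oi.
apply/orbitP; exists (activity (1 : tree_aut m)); last exact: activity1.
by rewrite inE; apply/asboolP; exists 1 => //; apply: A_subgroup.1.
Qed.

Lemma orbit_disj i j y : y \in O i -> y \in O j -> i = j.
Proof.
move=> yi yj; apply: O_orbits.1; apply/setP => z.
apply/idP/idP; [move: yi yj | move: yj yi] => y1 y2 /(orbit_trans y1).
  by case=> a Aa <-; apply: orbit_in.
by case=> a Aa <-; apply: orbit_in.
Qed.

(** * Elements of [Astar] built from [A] *)

Lemma state_in a y : A a -> A (state a y).
Proof.
by move=> Aa; apply: (A_selfsim Aa); apply: states_step; apply: states_refl.
Qed.

(** On [O i] the element [c] meets states of [a], which lie in [A] by self-similarity; off [O i] it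
    contributes nothing, since [a] preserves the complement. *)
Lemma centralizer_pd i c :
  centralizer A c -> centralizer A (partial_diag (O i) c).
Proof.
move=> Cc a Aa; apply/tree_commuteP => y; rewrite !activity_pd; split=> //.
rewrite !state_pd; case: ifPn => yOi.
  by rewrite orbit_in //; apply: Cc; apply: state_in.
by rewrite (negPf (orbit_notin Aa yOi)) mulg1 mul1g.
Qed.

Lemma Delta_centralizes_A : D `<=` centralizer A.
Proof.
apply: Delta_sub => [||i a]; first exact: centralizer_subgroup.
  by move=> a Aa b Ab; apply: A_abelian.
exact: centralizer_pd.
Qed.

(** The centralizer of [c] is a subgroup, so [Delta_ind] reduces membership in [Astar] to these two
    tests. *)
Lemma Astar_intro c : (forall a, A a -> commute c a) ->
  (forall i d, D d -> commute c (partial_diag (O i) d)) -> Astar c.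
Proof.
move=> cA cD; suff Dc : D `<=` centralizer [set c].
  by move=> d /Dc /(_ c erefl) /commute_sym.
apply: Delta_ind => [|a Aa _ ->|i d Dd _ ->]; first exact: centralizer_subgroup.
  exact/commute_sym/cA.
exact/commute_sym/cD.
Qed.

Lemma Astar_pd i c : Astar c -> Astar (partial_diag (O i) c).
Proof.
move=> Cc; apply: Astar_intro => [a Aa|j d Dd].
  by apply: centralizer_pd Aa => b Ab; apply: Cc; apply: sub_Delta.
apply/tree_commuteP => y; rewrite !activity_pd; split=> //; rewrite !state_pd.
by case: ifP; case: ifP; rewrite ?mulg1 ?mul1g // => _ _; apply: Cc.
Qed.

Lemma A_sub_Astar : A `<=` Astar.
Proof. by move=> a Aa d Dd; apply/commute_sym/Delta_centralizes_A. Qed.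

(** Equivalently, [Delta O A] is abelian. *)
Lemma Delta_sub_Astar : D `<=` Astar.
Proof.
apply: Delta_sub => [||i a]; first exact: centralizer_subgroup.
  exact: A_sub_Astar.
exact: Astar_pd.
Qed.

Lemma activity_orbit_part i a y :
  A a -> y \in O i -> activity (orbit_part (O i) a) y = activity a y.
Proof. by move=> Aa; apply: activity_op_in => z; apply: orbit_in. Qed.

Lemma orbit_part_in i a y :
  A a -> y \in O i -> activity (orbit_part (O i) a) y \in O i.
Proof. by move=> Aa yOi; rewrite activity_orbit_part // orbit_in. Qed.

(** On [O i] this part agrees with [a], and elsewhere it is trivial. It commutes with [A] because
    [A] is abelian, and with [x_j(d)] because [D] centralizes the states of [a]. *)
Lemma Astar_orbit_part i a : A a -> Astar (orbit_part (O i) a).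
Proof.
move=> Aa; apply: Astar_intro => [b Ab|j d Dd]; apply/tree_commuteP => y.
  rewrite !state_op; case: ifPn => yOi.
    rewrite !activity_orbit_part ?orbit_in //.
    by move: y {yOi}; apply/tree_commuteP; apply: A_abelian.
  have byi := orbit_notin Ab yOi.
  by rewrite !activity_op_out // (negPf byi) mulg1 mul1g.
rewrite !activity_pd; split=> //; rewrite !state_op !state_pd.
have [yOi|yOi] := boolP (y \in O i); last by rewrite activity_op_out ?mulg1 ?mul1g.
rewrite activity_orbit_part //; have [yOj|yOj] := boolP (y \in O j).
  by rewrite orbit_in //; apply/commute_sym/(Delta_centralizes_A Dd)/state_in.
by rewrite (negPf (orbit_notin Aa yOj)) mulg1 mul1g.
Qed.

Lemma activity_Astar_eq c i y z : Astar c -> y \in O i -> z \in O i ->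
  exists2 a, A a & activity a y = z /\ activity c z = activity a (activity c y).
Proof.
move=> Cc yi zi; have [a Aa <-] := orbit_trans yi zi; exists a => //.
split=> //; have /tree_commuteP/(_ y)[<- _] // := Cc a (sub_Delta Aa).
Qed.

(** * Activity and states of an element of [Astar] on one orbit *)

Hypothesis A_neq1 : A <> [set 1].

(** If [c] moved [y] out of [O i], commuting with [x_i(b)] would give [state c y = b * state c y]
    and so [b = 1]. A nontrivial [b] is essential: for trivial [A], the centralizer is all of
    [tree_aut m]. *)
Lemma Astar_orbit c i y : Astar c -> y \in O i -> activity c y \in O i.
Proof.
have [b [Ab b1]] : exists b, A b /\ b <> 1.
  apply: contrapT => h; apply: A_neq1; rewrite predeqE => b.
  split=> [Ab|->]; last exact: A_subgroup.1.
  by apply: contrapT => b1; apply: h; exists b.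
move=> Cc yi; apply: contraT => cyi; case: b1.
have := Cc _ (Delta_pd i (sub_Delta Ab)).
move=> /tree_commuteP/(_ y)[_]; rewrite !state_pd activity_pd yi (negPf cyi).
by rewrite mulg1 -[LHS]mul1g => /mulIg <-.
Qed.

Lemma Astar_orbit_im c i : Astar c -> (activity c @: O i)%SET = O i.
Proof.
move=> Cc; apply/eqP; rewrite eqEcard card_imset ?leqnn ?andbT; last first.
  exact: perm_inj.
by apply/fintype.subsetP => _ /imsetP[y yi ->]; apply: Astar_orbit.
Qed.

(** Choose [a] agreeing with [c] at a base point; both commute with the transitive action of [A], so
    they agree on the whole orbit. *)
Lemma Astar_activity c i : Astar c ->
  exists2 a, A a & forall y, y \in O i -> activity c y = activity a y.
Proof.
move=> Cc; have [y0 O0] := orbit_mem i.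
have y0i : y0 \in O i.
  by apply/O0; exists 1; [apply: A_subgroup.1 | rewrite activity1].
have [a Aa ay0] := orbit_trans y0i (Astar_orbit Cc y0i).
exists a => // y yi.
have [b Ab [<- ->]] := activity_Astar_eq Cc y0i yi.
by rewrite -ay0 -!activityM; congr (activity _ _); apply: A_abelian.
Qed.

(** Commuting with [x_i(d)] puts the state at the base point in [Astar]. It therefore commutes with
    the states of any [a] in [A] carrying the base point to [y], and these cancel when [c] is
    commuted with [a]. *)
Lemma Astar_state c i : Astar c ->
  (forall y, y \in O i -> activity c y = y) ->
  exists2 e, Astar e & forall y, y \in O i -> state c y = e.
Proof.
move=> Cc c1; have [y0 O0] := orbit_mem i.
have y0i : y0 \in O i.
  by apply/O0; exists 1; [apply: A_subgroup.1 | rewrite activity1].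
have Ce : Astar (state c y0).
  move=> d Dd; have /tree_commuteP/(_ y0)[_] := Cc _ (Delta_pd i Dd).
  by rewrite !state_pd activity_pd c1 // y0i.
exists (state c y0) => // y /(orbit_trans y0i)[a Aa <-].
have /tree_commuteP/(_ y0)[_] := Cc _ (sub_Delta Aa).
by rewrite c1 // Ce => [/mulgI //|]; apply: sub_Delta; apply: state_in.
Qed.

(** Dividing [c] by the orbit part of a suitable [a] makes it fix [O i] pointwise, so [Astar_state]
    supplies [e]. *)
Lemma Astar_local c i : Astar c -> exists a e, [/\ A a, Astar e &
  forall y, y \in O i ->
    activity c y = activity a y /\ state c y = e * state a y].
Proof.
move=> Cc; have [a Aa ca] := Astar_activity i Cc.
have [|y yi|e Ce ce] := @Astar_state (c * (orbit_part (O i) a)^-1) i.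
- by apply: (centralizer_subgroup D).2 => //; apply: Astar_orbit_part.
- rewrite activityM ca // -(activity_orbit_part Aa yi) -activityM mulgV.
  exact: activity1.
exists a, e; split=> // y yi; split; first exact: ca.
rewrite -[c](mulgKV (orbit_part (O i) a)) stateM ce // activityM ca //.
rewrite -(activity_orbit_part Aa yi) -[activity _^-1 _]activityM mulgV activity1.
by rewrite state_op yi.
Qed.

(** Induction on words: in [c * d] and [d * c] the factors from [A] agree because [a] and [b]
    commute, which leaves [c'] and [d'] in [Astar] acting on a shorter word. *)
Lemma Astar_abelian : is_abelian Astar.
Proof.
move=> c d Cc Cd; apply: tree_autP => w.
elim: w c d Cc Cd => [|y w IH] c d Cc Cd; first by rewrite !tree_nil.
have [i yi] := orbit_cover y.
have [a [c' [Aa Cc' cE]]] := Astar_local i Cc.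
have [b [d' [Ab Cd' dE]]] := Astar_local i Cd.
have [cy csy] := cE _ yi; have [dy dsy] := dE _ yi.
have [cby csby] := cE _ (orbit_in Ab yi).
have [day dsay] := dE _ (orbit_in Aa yi).
have /tree_commuteP/(_ y)[ab_y ab_s] := A_abelian Aa Ab.
have As e g z : Astar e -> A g -> commute e (state g z).
  by move=> Ce Ag; apply: Ce; apply: sub_Delta; apply: state_in.
rewrite !tree_cons !activityM !stateM cy dy day cby ab_y; congr cons.
(* Gathers the factors from [Astar] on the left and the states of [A] on the right. *)
have swap (p q r t : tree_aut m) :
    commute r q -> p * q * (r * t) = p * r * (q * t).
  by move=> rq; rewrite -!mulgA; congr (_ * _); rewrite !mulgA rq.
rewrite csy dsy csby dsay swap; last exact: As.
rewrite [in RHS]swap; last exact: As.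
(* The left factor acts first, so [c' * d'] is applied to [w] itself, as the induction hypothesis
   requires. *)
by rewrite ab_s [LHS]tree_mulE [RHS]tree_mulE IH.
Qed.

(** * Gluing the local descriptions over all orbits *)

Lemma pd_prod (e : 'I_s -> tree_aut m) i y : y \in O i ->
  activity (\prod_(j < s) partial_diag (O j) (e j)) y = y /\
  state (\prod_(j < s) partial_diag (O j) (e j)) y = e i.
Proof.
move=> yi; have e_in j z : z \in O j -> activity (partial_diag (O j) (e j)) z \in O j.
  by rewrite activity_pd.
have e_id j z w : z \notin O j -> partial_diag (O j) (e j) (z :: w) = z :: w.
  exact: partial_diag_id.
rewrite (activity_block_prod orbit_disj e_in e_id yi) activity_pd.
by rewrite (state_block_prod orbit_disj e_in e_id yi) state_pd yi.
Qed.

Lemma op_prod (f : 'I_s -> tree_aut m) i y : (forall j, A (f j)) -> y \in O i ->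
  activity (\prod_(j < s) orbit_part (O j) (f j)) y = activity (f i) y /\
  state (\prod_(j < s) orbit_part (O j) (f j)) y = state (f i) y.
Proof.
move=> Af yi.
have f_in j z : z \in O j -> activity (orbit_part (O j) (f j)) z \in O j.
  exact: orbit_part_in.
have f_id j z w : z \notin O j -> orbit_part (O j) (f j) (z :: w) = z :: w.
  exact: orbit_part_id.
rewrite (activity_block_prod orbit_disj f_in f_id yi) activity_orbit_part //.
by rewrite (state_block_prod orbit_disj f_in f_id yi) state_op yi.
Qed.

Lemma Astar_decomp c : Astar c -> exists e f : 'I_s -> tree_aut m,
  [/\ forall i, Astar (e i), forall i, A (f i) &
   c = \prod_(i < s) partial_diag (O i) (e i) *
       \prod_(i < s) orbit_part (O i) (f i)].
Proof.
move=> Cc; have [f fP] := choice (fun i => Astar_local i Cc).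
have [e efP] := choice fP.
have Af i : A (f i) by have [] := efP i.
exists e, f; split=> [i|//|]; first by have [] := efP i.
apply: eq_tree_aut => y; have [i yi] := orbit_cover y.
  have [_ _ /(_ y yi)[-> _]] := efP i.
  by rewrite activityM (pd_prod e yi).1 (op_prod Af yi).1.
have [_ _ /(_ y yi)[_ ->]] := efP i.
by rewrite stateM (pd_prod e yi).1 (pd_prod e yi).2 (op_prod Af yi).2.
Qed.

Lemma Astar_pd_prod (e : 'I_s -> tree_aut m) : (forall i, Astar (e i)) ->
  Stab Astar 1 (\prod_(i < s) partial_diag (O i) (e i)).
Proof.
move=> Ce; apply/Stab1P; split=> [|y].
  apply: subgroup_prod => [|i]; first exact: centralizer_subgroup.
  exact: Astar_pd.
by have [i yi] := orbit_cover y; have [] := pd_prod e yi.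
Qed.

Lemma Bgroup_sub_Astar : Bgroup O A `<=` Astar.
Proof.
move=> _ /setprodP[f fA ->].
apply: subgroup_prod => [|i]; first exact: centralizer_subgroup.
by have [a Aa <-] := fA i; apply: Astar_orbit_part.
Qed.

Lemma orbit_part_prod_Bgroup (f : 'I_s -> tree_aut m) : (forall i, A (f i)) ->
  Bgroup O A (\prod_(i < s) orbit_part (O i) (f i)).
Proof.
move=> Af; apply/setprodP; exists (fun i => orbit_part (O i) (f i)) => // i.
by exists (f i).
Qed.

Lemma Astar_Stab_Bgroup : Astar = set_prod (Stab Astar 1) (Bgroup O A).
Proof.
rewrite predeqE => c; split=> [/Astar_decomp[e [f [Ce Af ->]]]|].
  exists (\prod_(i < s) partial_diag (O i) (e i)); first exact: Astar_pd_prod.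
  exists (\prod_(i < s) orbit_part (O i) (f i)) => //.
  exact: orbit_part_prod_Bgroup.
case=> a [Ca _] [b /Bgroup_sub_Astar Cb <-].
exact: (subgroupM (centralizer_subgroup _) Ca Cb).
Qed.

Lemma Stab_Astar_eq :
  Stab Astar 1 = \setprod_(i < s) (partial_diag (O i) @` Astar).
Proof.
rewrite predeqE => c; split=> [/Stab1P[Cc c1]|/setprodP[f fP ->]].
  have /choice[e eP] i : exists e, Astar e /\ forall y, y \in O i -> state c y = e.
    by have [e Ce ce] := @Astar_state c i Cc (fun y _ => c1 y); exists e.
  apply/setprodP; exists (fun i => partial_diag (O i) (e i)) => [i|].
    by exists (e i) => //; have [] := eP i.
  apply: eq_tree_aut => y; have [i yi] := orbit_cover y.
    by rewrite c1 (pd_prod e yi).1.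
  by rewrite (pd_prod e yi).2; have [_ ->] := eP i.
have /choice[e eP] i : exists e, Astar e /\ partial_diag (O i) e = f i.
  by have [e] := fP i; exists e.
have -> : \prod_(i < s) f i = \prod_(i < s) partial_diag (O i) (e i).
  by apply: eq_bigr => i _; have [_ ->] := eP i.
by apply: Astar_pd_prod => i; have [] := eP i.
Qed.

(** * [Astar] as a topological closure *)

Lemma Delta_Bgroup_sub_Astar : Delta O (Bgroup O A) `<=` Astar.
Proof.
apply: Delta_sub => [||i a]; first exact: centralizer_subgroup.
  exact: Bgroup_sub_Astar.
exact: Astar_pd.
Qed.

(** In the decomposition of [c] the [orbit_part] factors already lie in [B(A)]; replacing each [e i]
    by an approximation on level [n] gives agreement on level [n + 1]. *)
Lemma Delta_Bgroup_approx n c : Astar c -> exists2 g,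
  Delta O (Bgroup O A) g & forall u, size u = n -> g u = c u.
Proof.
elim: n c => [|n IH] c Cc.
  exists 1; first exact: (Delta_subgroup _ _).1.
  by move=> u /size0nil ->; rewrite !tree_nil.
have [e [f [Ce Af ->]]] := Astar_decomp Cc.
have /choice[g gP] i : exists g, Delta O (Bgroup O A) g /\
    forall u, size u = n -> g u = e i u.
  by have [g] := IH _ (Ce i); exists g.
exists (\prod_(i < s) partial_diag (O i) (g i) *
        \prod_(i < s) orbit_part (O i) (f i)).
  apply: (subgroupM (Delta_subgroup _ _)).
    apply: (subgroup_prod (Delta_subgroup _ _)) => i.
    by apply: Delta_pd; have [] := gP i.
  by apply: sub_Delta; apply: orbit_part_prod_Bgroup.
move=> [|y u] // [un]; have [i yi] := orbit_cover y.
rewrite !tree_mulE !(tree_cons (\prod_(i < s) partial_diag _ _)).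
have [-> ->] := pd_prod g yi; have [-> ->] := pd_prod e yi.
by have [_ ->] := gP i.
Qed.

Lemma Astar_closure : Astar = closure (Delta O (Bgroup O A)).
Proof.
rewrite predeqE => c; split=> [Cc U [k _ kU]|cl_c d Dd].
  have [g Dg gc] := Delta_Bgroup_approx k Cc.
  by exists g; split=> //; apply/kU/tree_cosetP.
(* Centralizers are closed: [d] preserves length, so both sides at [w] involve [c] only on words of
   length [size w], where [g] agrees with it. *)
apply: tree_autP => w.
have [|g [/Delta_Bgroup_sub_Astar Cg /tree_cosetP gc]] :=
    cl_c [set c * b | b in Stab setT (size w)].
  by exists (size w).
by rewrite !tree_mulE -!gc ?tree_size // -!tree_mulE Cg.
Qed.

(** * Maximality, and triviality of the rigid part *)

Lemma Astar_maximal M : is_abelian M -> D `<=` M -> M `<=` Astar.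
Proof. by move=> Mab DM a Ma d /DM; apply: Mab. Qed.

(** Such a [xi] is the activity of an element of [Astar], so it preserves each orbit; being
    increasing there, it is the identity. *)
Lemma Sgroup_trivial xi : Sgroup D xi -> xi = 1.
Proof.
move=> [[_ xi_mono] [c [Cc [b /Stab1P[_ b1] bc]]]].
have cxi y : activity c y = xi y by rewrite -bc activityM b1 activity_wreath.
(* Rigidity refers to the orbits of [D]. These are the [O i]: [D] contains [A], so it is transitive
   on them, and lies in [Astar], so it preserves them. *)
have OD i : O i \in orbits1 D.
  have [y0 O0] := orbit_mem i; apply/imsetP; exists y0 => //.
  have y0i : y0 \in O i.
    by apply/O0; exists 1; [apply: A_subgroup.1 | rewrite activity1].
  apply/setP => z; apply/idP/orbitP => [/O0[a Aa <-]|[p]].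
    by exists (activity a) => //; rewrite inE; apply/asboolP; exists a => //;
      apply: sub_Delta.
  rewrite inE => /asboolP[d /Delta_sub_Astar Cd <-] <-.
  exact: Astar_orbit.
apply/permP => y; rewrite perm1; have [i yi] := orbit_cover y.
(* Strong induction on the letter: smaller letters of [O i] are already fixed. *)
have [n] := ubnP (val y); elim: n y yi => // n IH y yi; rewrite ltnS => yn.
have fixed z : z \in O i -> z < y -> xi z = z.
  by move=> zi zy; apply: IH => //; apply: leq_trans zy yn.
have xiy : xi y \in O i by rewrite -cxi Astar_orbit.
have : y \in (activity c @: O i)%SET by rewrite Astar_orbit_im.
case/imsetP => x xO; rewrite cxi => yx.
(* The preimage [x] of [y] cannot be smaller, as it would be fixed. Hence [y <= x], and monotonicity
   gives [xi y <= y]; a strict inequality would make [xi y] fixed, against injectivity. *)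
have [xy|y_le_x] := ltnP x y.
  by have := fixed _ xO xy; rewrite -yx => yE; rewrite yE ltnn in xy.
have le_xi : xi y <= y by rewrite {2}yx; apply: xi_mono (OD i) _ _ _ _ _.
have [lt_xi|ge_xi] := ltnP (xi y) y.
  by apply: perm_inj; apply: fixed.
by apply/val_inj/eqP; rewrite eqn_leq le_xi.
Qed.

(** Only the trivial permutation can have a lifting, and [lifting_choice] normalizes that lifting to
    [1]. *)
Lemma Rgroup_trivial lift : lifting_choice D lift -> Rgroup D lift = [set 1].
Proof.
move=> [_ lift1]; rewrite predeqE => g; split=> [|->]; last first.
  exact: (generated_subgroup _).1.
move: g; apply: smallest_sub => [|_ [xi /Sgroup_trivial -> <-]] //.
by split=> // _ _ -> ->; rewrite mulgV.
Qed.

End AbelianSelfSimilar.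

Theorem theorem4p4 (m : nat) (m_ge2 : (2 <= m)%N) (A : set (tree_aut m))
    (A_subgroup : is_subgroup A) (A_abelian : is_abelian A)
    (A_selfsim : self_similar A) (A_neq1 : A <> [set 1])
    (s : nat) (O : 'I_s -> {set 'I_m}) (O_orbits : orbit_numbering A O) :
  let Astar := centralizer (Delta O A) in
  [/\ [/\ forall a, Astar a -> forall i : 'I_s, (activity a @: O i)%SET = O i,
          forall lift, lifting_choice (Delta O A) lift ->
            Rgroup (Delta O A) lift = [set 1] &
          Astar = set_prod (Stab Astar 1) (Bgroup O A)],
      Stab Astar 1 = \setprod_(i < s) (partial_diag (O i) @` Astar),
      Astar = closure (Delta O (Bgroup O A)) &
      [/\ maximal_abelian Astar, Delta O A `<=` Astar &
          forall M, maximal_abelian M -> Delta O A `<=` M -> M = Astar]].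
Proof.
move=> Astar.
have DA : Delta O A `<=` Astar by apply: Delta_sub_Astar.
have Aab : is_abelian Astar by apply: Astar_abelian.
have As : is_subgroup Astar by apply: centralizer_subgroup.
split; [split| | |split] => //.
- by move=> a Ca i; apply: (Astar_orbit_im A_subgroup A_neq1).
- move=> lift; exact: (Rgroup_trivial A_subgroup A_abelian A_selfsim O_orbits).
- exact: Astar_Stab_Bgroup.
- exact: Stab_Astar_eq.
- exact: Astar_closure.
(* An abelian [H] above [Astar] contains [Delta O A], hence centralizes it. *)
- split=> // H _ Hab AH; apply/seteqP; split=> //.
  by apply: Astar_maximal => // a /DA /AH.
(* [M] is abelian and contains [Delta O A], so it lies in the abelian group [Astar]; its maximality
   forces equality. *)
- move=> M [_ Mab Mmax] DM.
  by rewrite (Mmax Astar) //; apply: Astar_maximal.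
Qed.
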